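(* Let $m$ be a positive integer, $q=2^m$, and $F=\mathbb{F}_q$. Let $b\in F$ and let $n,k$ be rational numbers such that $b^n,b^k$ are elements of $F$. Suppose that $b^{4n}+1\neq 0$ and that the two arguments of $K$ below are nonzero. Then $$K\left(\frac{(b^{n+2}+b^k+1)(b^{n+2}+b^n+b^k)^3}{b^{4n}+1}\right)=K\left(\frac{(b^{n+2}+b^k+1)^3(b^{n+2}+b^n+b^k)}{b^{4n}+1}\right).$$
   Context: $F=\mathbb{F}_q$ is the finite field with $q=2^m$ elements, $F^*=F\setminus\{0\}$, and $\mathrm{Tr}$ is the absolute trace function of $F$ over $\mathbb{F}_2$. For $a\in F^*$ the Kloosterman sum is $K(a)=\sum_{x\in F^*}(-1)^{\mathrm{Tr}(ax+1/x)}$. Rational powers: for a rational number $t=r/s$ in lowest terms with $s>0$, $b^t$ denotes a fixed element $d\in F$ with $d^s=b^r$ (with $b\neq 0$ if $r<0$, and $b^0=1$); $b^{n+2}=b^2\cdot b^n$ and $b^{4n}=(b^n)^4$. *)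

(* Defs.v *)
From HB Require Import structures.
From mathcomp Require Import all_boot all_order all_algebra all_field.

Set Implicit Arguments.
Unset Strict Implicit.
Unset Printing Implicit Defensive.

Import GRing.Theory.
Local Open Scope ring_scope.

(* Meant for #|F| = 2 ^ m, where the number of terms is m = [F : F_2]. *)
Definition abs_trace (F : finFieldType) (x : F) : F :=
  \sum_(i < logn 2 #|F|) x ^+ (2 ^ i).

(* The trace takes its values in the prime field {0, 1} of F, so the sign
   (-1)^Tr(y) can be written with the boolean exponent abs_trace y == 1. *)
Lemma abs_trace_01 (m : nat) (F : finFieldType) (x : F) :
  #|F| = (2 ^ m)%N -> (abs_trace x == 0) || (abs_trace x == 1).
Proof.
move=> cardF.
have char2 : 2 \in [pchar F] by exact: card_finPcharP cardF _.
have trE : abs_trace x ^+ 2 = abs_trace x.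
  rewrite -[LHS](pFrobenius_autE char2) /abs_trace rmorph_sum /=.
  rewrite cardF pfactorK //.
  under eq_bigr do rewrite pFrobenius_autE -exprM -expnSr.
  case: m cardF => [|m] cardF; first by rewrite !big_ord0.
  by rewrite big_ord_recr big_ord_recl /= -cardF expf_card addrC expn0 expr1.
rewrite -[abs_trace x == 1]subr_eq0 -mulf_eq0 mulrBr mulr1 -expr2 trE.
by rewrite subrr.
Qed.

Definition kloosterman (F : finFieldType) (a : F) : int :=
  \sum_(x : F | x != 0) (-1) ^+ (abs_trace (a * x + x^-1) == 1).

(* d is a value of b^t: numq t / denq t is t in lowest terms, denq t > 0.
   When b = 0 and t < 0 there is no such value; b^0 has the only value 1,
   including for b = 0. *)
Definition is_rat_power (F : fieldType) (b : F) (t : rat) (d : F) : Prop :=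
  (numq t < 0 -> b != 0) /\ d ^ denq t = b ^ numq t.

(* Main.v *)
Require Import Defs.
From HB Require Import structures.
From mathcomp Require Import all_boot all_order all_algebra all_field.
From mathcomp Require Import ring.

Set Implicit Arguments.
Unset Strict Implicit.
Unset Printing Implicit Defensive.

Import GRing.Theory.
Local Open Scope ring_scope.

(** Write A and B for the two factors of the arguments.  In characteristic 2,
    A + B = bn + 1, so bn^4 + 1 = (A + B)^4, and with s = A / (A + B) the claim
    is K(s (1+s)^3) = K(s^3 (1+s)).

    Since squaring is an automorphism that preserves the trace, K(a^2) is the
    sum over x != 0 of (-1)^Tr(x + a/x), which is, up to a constant depending
    on q only, the number of points of the curve y^2 + xy = x^3 + a^2.  For s = r^2 the curves of parameters
    a = r^3 (1+r) and a' = r (1+r)^3 are 3-isogenous: the first one has a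
    subgroup of order 3 whose nonzero points have abscissa r^2.  On abscissas,
    the quotient by this subgroup is
      phi(x) = x (x + r^2 + r)^2 / (x + r^2)^2,
    and phi(x) + a'/phi(x) differs from x + a/x by an element h^2 + h, so the
    trace is transported by phi ([abs_trace_isogeny]).

    Let S be the set of x != 0 with Tr(x + a/x + r) = 1, and S' the same set
    for a'.  Each sum is determined by the cardinal of its set
    ([kloosterman_sqr_card]), so it is enough that phi is a bijection from S to
    S'.  In terms of u = x / (x + r^2), the equation phi(x) = X is the cubic
      u^3 + (X + (r+1)^2) u + X = 0,
    and a nonzero X is in S' exactly when Tr(1 + c^3/d^2) = 1 for its
    coefficients c and d ([abs_trace_isogeny_cubic]).  A cubic u^3 + c u + d with that property has exactly one root: two
    distinct roots would make 1 + c^3/d^2 of the form t^2 + t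
    ([cubic_root_unique]), and for existence when c != 0, after scaling to
    c = 1, the map u |-> u^3 + u sends the finite set
    {u != 0 | Tr(1 + 1/u) = 1} injectively into itself ([cubic_root_exists]). *)

(** * The absolute trace *)

(** The way identities of characteristic 2 are proved below: they become
    identities over the integers once the multiple 2 z is made explicit. *)
Lemma eq_mod2 (R : nzRingType) (x y z : R) :
  2 \in [pchar R] -> x = y + 2%:R * z -> x = y.
Proof. by move=> char2 ->; rewrite (pcharf0 char2) mul0r addr0. Qed.

Lemma pchar2_card (m : nat) (F : finFieldType) :
  #|F| = (2 ^ m)%N -> 2 \in [pchar F].
Proof. by move=> cardF; apply: card_finPcharP cardF _. Qed.

Lemma abs_trace0 (F : finFieldType) : abs_trace (0 : F) = 0.
Proof. by apply: big1 => i _; rewrite expr0n expn_eq0. Qed.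

Lemma abs_traceD (F : finFieldType) (x y : F) :
  2 \in [pchar F] -> abs_trace (x + y) = abs_trace x + abs_trace y.
Proof.
move=> char2; rewrite /abs_trace -big_split; apply: eq_bigr => i _ /=.
by rewrite exprDn_pchar // pnatX pnatE ?char2.
Qed.

Lemma abs_trace_sqr (m : nat) (F : finFieldType) (x : F) :
  #|F| = (2 ^ m)%N -> abs_trace (x ^+ 2) = abs_trace x.
Proof.
move=> cardF; have char2 := pchar2_card cardF.
have -> : abs_trace (x ^+ 2) = abs_trace x ^+ 2.
  rewrite -(pFrobenius_autE char2 (abs_trace x)) rmorph_sum.
  by apply: eq_bigr => i _; rewrite /= pFrobenius_autE -!exprM mulnC.
by case/orP: (abs_trace_01 x cardF) => /eqP ->; rewrite ?expr0n ?expr1n.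
Qed.

Lemma abs_trace_artin_schreier (m : nat) (F : finFieldType) (x h : F) :
  #|F| = (2 ^ m)%N -> abs_trace (x + (h ^+ 2 + h)) = abs_trace x.
Proof.
move=> cardF; have char2 := pchar2_card cardF.
by rewrite !abs_traceD // (abs_trace_sqr _ cardF) addrr_pchar2 // addr0.
Qed.

Lemma sqr_inj (F : fieldType) :
  2 \in [pchar F] -> injective (fun x : F => x ^+ 2).
Proof.
move=> char2 x y /eqP; rewrite eqf_sqr => /orP[] /eqP -> //.
exact: oppr_pchar2.
Qed.

Lemma sqr_surj (F : finFieldType) (c : F) :
  2 \in [pchar F] -> exists g : F, g ^+ 2 = c.
Proof.
move=> char2; exists (invF (sqr_inj char2) c).
exact: (f_invF (sqr_inj char2)).
Qed.

(** * Cubics with exactly one root *)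

(** Here t^2 + t + (1 + c^3/d^2) is the quadratic resolvent of the cubic: if
    x, y and z = x + y are its roots, t = (x^2 y + y^2 z + z^2 x) / d solves
    it. *)
Lemma cubic_root_unique (m : nat) (F : finFieldType) (c d x y : F) :
  #|F| = (2 ^ m)%N -> d != 0 -> abs_trace (1 + c ^+ 3 / d ^+ 2) = 1 ->
  x ^+ 3 + c * x + d = 0 -> y ^+ 3 + c * y + d = 0 -> x = y.
Proof.
move=> cardF d0 trd rootx rooty; apply/eqP; apply: contraT => neq_xy.
have char2 := pchar2_card cardF.
have cE : c = - (x ^+ 2 + x * y + y ^+ 2).
  have xy0 : x - y != 0 by rewrite subr_eq0.
  apply: (mulfI xy0); apply/eqP; rewrite -subr_eq0.
  by rewrite -[X in _ == X](subrr 0) -{1}rootx -rooty; apply/eqP; ring.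
have dE : d = x * y * (x + y).
  by apply/eqP; rewrite -subr_eq0 -rootx cE; apply/eqP; ring.
pose z := - (x + y).
pose t := (x ^+ 2 * y + y ^+ 2 * z + z ^+ 2 * x) / d.
have E : 1 + c ^+ 3 / d ^+ 2 = 0 + (t ^+ 2 + t).
  apply: (eq_mod2 (z := t - t ^+ 2 - 4%:R)) => //.
  move: d0; rewrite /t /z cE dE !mulf_eq0 !negb_or => /andP[/andP[x0 y0] xy0].
  by field; rewrite x0 y0 xy0.
by move: trd; rewrite E (abs_trace_artin_schreier _ _ cardF) abs_trace0
   => /esym/eqP; rewrite oner_eq0.
Qed.

(** The partial fraction 1/(u (u+1)^2) = 1/u + 1/(u+1) + 1/(u+1)^2 shows that
    u |-> u^3 + u preserves Tr(1 + 1/u), hence permutes the set where it is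
    1. *)
Lemma cubic_root_exists1 (m : nat) (F : finFieldType) (e : F) :
  #|F| = (2 ^ m)%N -> e != 0 -> abs_trace (1 + e^-1) = 1 ->
  exists u : F, u ^+ 3 + u = e.
Proof.
move=> cardF e0 tre; have char2 := pchar2_card cardF.
pose A := [set u : F | (u != 0) && (abs_trace (1 + u^-1) == 1)].
pose f (u : F) := u ^+ 3 + u.
have fA u : u \in A -> f u \in A.
  rewrite !inE => /andP[u0 tru].
  have u10 : u + 1 != 0.
    apply: contraTneq tru => /eqP.
    rewrite addr_eq0 oppr_pchar2 // => /eqP ->.
    by rewrite invr1 addrr_pchar2 // abs_trace0 eq_sym oner_eq0.
  have fE : f u = u * (u + 1) ^+ 2.
    by apply: (eq_mod2 (z := - u ^+ 2)) => //; rewrite /f; ring.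
  rewrite fE mulf_neq0 ?expf_neq0 //=.
  rewrite (_ : 1 + (u * (u + 1) ^+ 2)^-1
               = 1 + u^-1 + ((u + 1)^-1 ^+ 2 + (u + 1)^-1)).
    by rewrite (abs_trace_artin_schreier _ _ cardF).
  apply: (eq_mod2 (z := - ((u + 1)^-1 ^+ 2 + (u + 1)^-1))) => //.
  by field; rewrite u0 u10.
have f_inj : {in A &, injective f}.
  move=> u v /fA; rewrite inE => /andP[fu0 trfu] _ fuv.
  apply: (cubic_root_unique (c := 1) (d := f u) cardF fu0).
  - rewrite -[RHS](eqP trfu) -[RHS](abs_trace_sqr _ cardF); congr abs_trace.
    by apply: (eq_mod2 (z := - (f u)^-1)) => //; field.
  - by rewrite mul1r addrr_pchar2.
  - by rewrite mul1r fuv addrr_pchar2.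
have fAA : f @: A = A.
  apply/eqP; rewrite eqEcard card_in_imset // leqnn andbT.
  by apply/subsetP => _ /imsetP[u uA ->]; apply: fA.
have : e \in f @: A by rewrite fAA inE e0 tre eqxx.
by case/imsetP => u _ ->; exists u.
Qed.

Lemma cubic_root_exists (m : nat) (F : finFieldType) (c d : F) :
  #|F| = (2 ^ m)%N -> d != 0 -> abs_trace (1 + c ^+ 3 / d ^+ 2) = 1 ->
  exists u : F, u ^+ 3 + c * u + d = 0.
Proof.
move=> cardF d0 trd; have char2 := pchar2_card cardF.
have [c0 | c0] := eqVneq c 0.
  (* The hypothesis says Tr(1) = 1, that is, there is no primitive cube root of
     unity, so that cubing is a permutation. *)
  have tr1 : abs_trace (1 : F) = 1.
    by rewrite -[RHS]trd c0 expr0n mul0r addr0.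
  have cube_inj : injective (fun u : F => u ^+ 3).
    move=> u v /= uv; have [u0 | u0] := eqVneq u 0.
      by apply/esym/eqP; move/eqP: uv; rewrite u0 expr0n eq_sym expf_eq0.
    apply: (cubic_root_unique (c := 0) (d := u ^+ 3) cardF);
      rewrite ?expf_neq0 ?mul0r ?addr0 -?uv ?addrr_pchar2 //.
    by rewrite expr0n mul0r addr0.
  exists (invF cube_inj d).
  by rewrite (f_invF cube_inj) c0 mul0r addr0 addrr_pchar2.
have [g gE] := sqr_surj c char2.
have g0 : g != 0 by apply: contra_neq c0 => g0; rewrite -gE g0 expr0n.
have [||w wE] := @cubic_root_exists1 m F (d / g ^+ 3) cardF.
- by rewrite mulf_neq0 ?invr_eq0 ?expf_neq0.
- rewrite -[RHS]trd -[LHS](abs_trace_sqr _ cardF) -gE; congr abs_trace.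
  by apply: (eq_mod2 (z := g ^+ 3 / d)) => //; field; rewrite d0 g0.
exists (g * w); apply: (eq_mod2 (z := d)) => //.
have dE : d = g ^+ 3 * (w ^+ 3 + w) by rewrite wE; field.
by rewrite -gE {1}dE dE; ring.
Qed.

(** * Kloosterman sums as cardinals *)

(** The substitution x = y^(-2) turns Tr(a^2 x + 1/x) into
    Tr((y + a/y)^2). *)
Lemma kloosterman_sqr (m : nat) (F : finFieldType) (a : F) :
  #|F| = (2 ^ m)%N ->
  kloosterman (a ^+ 2)
  = \sum_(y : F | y != 0) (-1) ^+ (abs_trace (y + a / y) == 1).
Proof.
move=> cardF; have char2 := pchar2_card cardF.
rewrite /kloosterman (reindex_inj (inj_comp (sqr_inj char2) invr_inj)) /=.
apply: eq_big => [y|y _]; first by rewrite expf_eq0 invr_eq0.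
rewrite -[abs_trace (y + _)](abs_trace_sqr _ cardF).
congr (_ ^+ (abs_trace _ == 1)).
rewrite exprVn invrK; apply: (eq_mod2 (z := - (y * (a / y)))) => //.
by rewrite -exprVn; ring.
Qed.

(** For any shift r, the cardinal of this set determines the sum
    [kloosterman (a ^+ 2)], since the trace takes two values.  The shift used
    for the isogeny turns the trace condition into the criterion for a cubic to
    have a unique root. *)
Definition trace1_set (F : finFieldType) (r a : F) : {set F} :=
  [set x : F | (x != 0) && (abs_trace (x + a / x + r) == 1)].

Lemma kloosterman_sqr_card (m : nat) (F : finFieldType) (r a : F) :
  #|F| = (2 ^ m)%N ->
  kloosterman (a ^+ 2) = (-1) ^+ (abs_trace r == 1)
    * (\sum_(x : F | x != 0) 1 - #|trace1_set r a|%:R *+ 2).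
Proof.
move=> cardF; have char2 := pchar2_card cardF.
rewrite (kloosterman_sqr a cardF) -sum1_card natr_sum -sumrMnl.
rewrite [X in _ - X](eq_bigl
  (fun x => (x != 0) && (abs_trace (x + a / x + r) == 1)));
  last by move=> x; rewrite inE.
rewrite big_mkcondr -sumrB mulr_sumr; apply: eq_bigr => x _.
rewrite [abs_trace (_ + r)]abs_traceD //.
have one1 : (1 + 1 == 1 :> F) = false.
  by rewrite addrr_pchar2 // eq_sym oner_eq0.
case/orP: (abs_trace_01 r cardF) => /eqP ->;
  case/orP: (abs_trace_01 (x + a / x) cardF) => /eqP ->;
  by rewrite ?addr0 ?add0r ?one1 ?eqxx ?[0 == 1]eq_sym ?oner_eq0.
Qed.

(** * The isogeny *)

(** The action of the 3-isogeny on abscissas: Velu's formula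
    x(P) + x(P + T) + x(P - T) for a point T of order 3 with abscissa r^2. *)
Definition isogeny_map (F : fieldType) (r x : F) : F :=
  x * (x + r ^+ 2 + r) ^+ 2 / (x + r ^+ 2) ^+ 2.

Lemma abs_trace_isogeny (m : nat) (F : finFieldType) (r x : F) :
  #|F| = (2 ^ m)%N -> x != 0 -> x + r ^+ 2 != 0 -> x + r ^+ 2 + r != 0 ->
  abs_trace (isogeny_map r x + r * (1 + r) ^+ 3 / isogeny_map r x + r)
  = abs_trace (x + r ^+ 3 * (1 + r) / x + r).
Proof.
move=> cardF x0 D0 E0; have char2 := pchar2_card cardF.
(* With a and a' the two parameters, phi(x) = x + p + p^2 and
   a'/phi(x) = a/x + q + q^2. *)
pose p := r ^+ 2 / (x + r ^+ 2).
pose q := (r ^+ 2 + r) / (x + r ^+ 2 + r).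
rewrite -[RHS](abs_trace_artin_schreier _ p cardF).
rewrite -[RHS](abs_trace_artin_schreier _ q cardF).
congr abs_trace; apply: (eq_mod2 (z :=
  x * r / (x + r ^+ 2)
  + (r ^+ 2 + r) * (r * x + r ^+ 2 + r ^+ 3) / (x + r ^+ 2 + r) ^+ 2
  - p ^+ 2 - q ^+ 2)) => //.
by rewrite /isogeny_map /p /q; field; rewrite x0 D0 E0.
Qed.

(** For the cubic with roots u = x / (x + r^2), phi(x) = X, the invariant
    1 + c^3/d^2 is the quantity X + a'/X + r up to some h^2 + h. *)
Lemma abs_trace_isogeny_cubic (m : nat) (F : finFieldType) (r X : F) :
  #|F| = (2 ^ m)%N -> X != 0 ->
  abs_trace (1 + (X + (r + 1) ^+ 2) ^+ 3 / X ^+ 2)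
  = abs_trace (X + r * (1 + r) ^+ 3 / X + r).
Proof.
move=> cardF X0; have char2 := pchar2_card cardF.
pose h := (r + 1) ^+ 3 / X + (r + 1).
rewrite -[RHS](abs_trace_artin_schreier _ h cardF); congr abs_trace.
apply: (eq_mod2 (z := 1 + (r + 1) ^+ 2 - (r + 1))) => //.
by rewrite /h; field.
Qed.

Lemma isogeny_cubic (F : fieldType) (r x : F) :
  2 \in [pchar F] -> x + r ^+ 2 != 0 ->
  let u := x / (x + r ^+ 2) in
  u ^+ 3 + (isogeny_map r x + (r + 1) ^+ 2) * u + isogeny_map r x = 0.
Proof.
move=> char2 D0 /=; set E := x + r ^+ 2 + r.
apply: (eq_mod2 (z := x / (x + r ^+ 2) ^+ 3
  * (x * E ^+ 2 + r ^+ 2 * E ^+ 2 + x ^+ 2 + r * E * x))) => //.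
by rewrite /E /isogeny_map; field.
Qed.

(** At the nonzero points that phi sends to infinity or to 0, x + a/x = r, so the
    condition Tr(x + a/x + r) = 1 excludes them. *)
Lemma trace1_set_regular (F : finFieldType) (r x : F) :
  2 \in [pchar F] -> r != 0 -> x \in trace1_set r (r ^+ 3 * (1 + r)) ->
  (x + r ^+ 2 != 0) && (x + r ^+ 2 + r != 0).
Proof.
move=> char2 r0; rewrite inE => /andP[x0 trx].
have nz : x + r ^+ 3 * (1 + r) / x + r != 0.
  by apply: contraTneq trx => ->; rewrite abs_trace0 eq_sym oner_eq0.
apply/andP; split; apply: contraNneq nz => /eqP.
  rewrite addr_eq0 => /eqP xE; apply/eqP.
  apply: (eq_mod2 (z := - r ^+ 2)) => //; rewrite xE; field.
  by rewrite oppr_eq0 expf_neq0.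
rewrite -addrA addr_eq0 => /eqP xE; apply/eqP.
apply: (eq_mod2 (z := - r ^+ 2)) => //; rewrite xE; field.
by move: x0; rewrite xE oppr_eq0.
Qed.

(** Two points with the same image give two roots u = x / (x + r^2) of the same
    cubic, and x is determined by u. *)
Lemma isogeny_inj (m : nat) (F : finFieldType) (r : F) :
  #|F| = (2 ^ m)%N -> r != 0 ->
  {in trace1_set r (r ^+ 3 * (1 + r)) &, injective (isogeny_map r)}.
Proof.
move=> cardF r0 x y xS yS xy; have char2 := pchar2_card cardF.
have /andP[Dx Ex] := trace1_set_regular char2 r0 xS.
have /andP[Dy _] := trace1_set_regular char2 r0 yS.
move: xS; rewrite inE => /andP[x0 trx].
have X0 : isogeny_map r x != 0.
  by rewrite !mulf_neq0 ?invr_eq0 ?expf_neq0.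
have uv : x / (x + r ^+ 2) = y / (y + r ^+ 2).
  apply: (cubic_root_unique cardF X0 _ (isogeny_cubic char2 Dx)).
    rewrite (abs_trace_isogeny_cubic _ cardF) //.
    by rewrite (abs_trace_isogeny cardF) // (eqP trx).
  by rewrite xy; apply: isogeny_cubic.
apply: (mulfI (expf_neq0 2 r0)); apply: (addrI (x * y)).
have: x * (y + r ^+ 2) = y * (x + r ^+ 2) by apply/eqP; rewrite -eqr_div // uv.
by rewrite !mulrDr ![_ * r ^+ 2]mulrC [y * x]mulrC.
Qed.

(** A root u of the cubic attached to X yields the preimage x = r^2 u / (u + 1),
    and the trace condition then passes from X to x. *)
Lemma isogeny_surj (m : nat) (F : finFieldType) (r X : F) :
  #|F| = (2 ^ m)%N -> r != 0 -> X \in trace1_set r (r * (1 + r) ^+ 3) ->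
  exists2 x, x \in trace1_set r (r ^+ 3 * (1 + r)) & X = isogeny_map r x.
Proof.
move=> cardF r0; rewrite inE => /andP[X0 trX]; have char2 := pchar2_card cardF.
have [|u uE] := @cubic_root_exists m F (X + (r + 1) ^+ 2) X cardF X0.
  by rewrite (abs_trace_isogeny_cubic _ cardF) // (eqP trX).
have u0 : u != 0.
  apply: contra_neq X0 => u0; move: uE.
  by rewrite u0 expr0n mulr0 !add0r.
have u1 : 1 - u != 0.
  apply: contra_neq (expf_neq0 2 r0) => /eqP; rewrite subr_eq0 => /eqP u1.
  rewrite -uE -u1; symmetry.
  by apply: (eq_mod2 (z := X + r + 1)) => //; ring.
pose x := r ^+ 2 * u / (1 - u).
have DE : x + r ^+ 2 = r ^+ 2 / (1 - u) by rewrite /x; field.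
have D0 : x + r ^+ 2 != 0 by rewrite DE mulf_neq0 ?invr_eq0 ?expf_neq0.
have x0 : x != 0 by rewrite !mulf_neq0 ?invr_eq0 ?expf_neq0.
have xu : x / (x + r ^+ 2) = u by rewrite DE /x; field; rewrite r0 u1.
(* The cubic is affine in X, with leading coefficient u + 1. *)
have XE : X = isogeny_map r x.
  have := isogeny_cubic char2 D0; rewrite /= xu => uE'.
  have u1' : 1 + u != 0 by rewrite -[u]oppr_pchar2.
  apply/eqP; rewrite -subr_eq0 -(mulrI_eq0 _ (mulfI u1')) -[0](subrr 0).
  by rewrite -{1}uE -uE'; apply/eqP; ring.
have E0 : x + r ^+ 2 + r != 0.
  by apply: contra_neq X0 => E0; rewrite XE /isogeny_map E0 expr0n mulr0 mul0r.
by exists x => //; rewrite inE x0 -(abs_trace_isogeny cardF) // -XE trX.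
Qed.

Lemma card_trace1_set (m : nat) (F : finFieldType) (r : F) :
  #|F| = (2 ^ m)%N -> r != 0 ->
  #|trace1_set r (r ^+ 3 * (1 + r))| = #|trace1_set r (r * (1 + r) ^+ 3)|.
Proof.
move=> cardF r0; have char2 := pchar2_card cardF.
rewrite -(card_in_imset (isogeny_inj cardF r0)); apply: eq_card => X.
apply/imsetP/idP => [[x xS ->] | /(isogeny_surj cardF r0) //].
have /andP[D0 E0] := trace1_set_regular char2 r0 xS.
move: xS; rewrite !inE => /andP[x0 trx].
by rewrite (abs_trace_isogeny cardF) // trx !mulf_neq0 ?invr_eq0 ?expf_neq0.
Qed.

(** * The identity *)

Lemma kloosterman_cube (m : nat) (F : finFieldType) (s : F) :
  #|F| = (2 ^ m)%N ->
  kloosterman (s * (1 + s) ^+ 3) = kloosterman (s ^+ 3 * (1 + s)).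
Proof.
move=> cardF; have char2 := pchar2_card cardF.
have [r rE] := sqr_surj s char2.
have [r0 | r0] := eqVneq r 0; first by rewrite -rE r0 !expr0n !mul0r.
have sE : 1 + s = (1 + r) ^+ 2.
  by apply: (eq_mod2 (z := - r)) => //; rewrite -rE; ring.
have -> : s * (1 + s) ^+ 3 = (r * (1 + r) ^+ 3) ^+ 2 by rewrite sE -rE; ring.
have -> : s ^+ 3 * (1 + s) = (r ^+ 3 * (1 + r)) ^+ 2 by rewrite sE -rE; ring.
by rewrite !(kloosterman_sqr_card r _ cardF) (card_trace1_set cardF r0).
Qed.

Theorem theorem5 (m : nat) (F : finFieldType) (b : F) (n k : rat) (bn bk : F) :
  (0 < m)%N ->
  #|F| = (2 ^ m)%N ->
  is_rat_power b n bn ->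
  is_rat_power b k bk ->
  bn ^+ 4 + 1 != 0 ->
  (b ^+ 2 * bn + bk + 1) * (b ^+ 2 * bn + bn + bk) ^+ 3 / (bn ^+ 4 + 1) != 0 ->
  (b ^+ 2 * bn + bk + 1) ^+ 3 * (b ^+ 2 * bn + bn + bk) / (bn ^+ 4 + 1) != 0 ->
  kloosterman
    ((b ^+ 2 * bn + bk + 1) * (b ^+ 2 * bn + bn + bk) ^+ 3 / (bn ^+ 4 + 1)) =
  kloosterman
    ((b ^+ 2 * bn + bk + 1) ^+ 3 * (b ^+ 2 * bn + bn + bk) / (bn ^+ 4 + 1)).
Proof.
move=> _ cardF _ _ bn0 _ _; have char2 := pchar2_card cardF.
set A := b ^+ 2 * bn + bk + 1; set B := b ^+ 2 * bn + bn + bk.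
have bnE : bn ^+ 4 + 1 = (A + B) ^+ 4.
  have -> : A + B = bn + 1.
    by apply: (eq_mod2 (z := b ^+ 2 * bn + bk)) => //; rewrite /A /B; ring.
  apply: (eq_mod2 (z := - (bn ^+ 3 *+ 2 + bn ^+ 2 *+ 3 + bn *+ 2))) => //.
  by ring.
have AB0 : A + B != 0 by move: bn0; rewrite bnE expf_eq0.
have sE : 1 + A / (A + B) = B / (A + B).
  by apply: (eq_mod2 (z := A / (A + B))) => //; field.
have := kloosterman_cube (A / (A + B)) cardF; rewrite sE bnE.
rewrite (_ : A / (A + B) * (B / (A + B)) ^+ 3 = A * B ^+ 3 / (A + B) ^+ 4);
  last by field.
by rewrite (_ : (A / (A + B)) ^+ 3 * (B / (A + B)) = A ^+ 3 * B / (A + B) ^+ 4);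
  last by field.
Qed.
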